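(* Let $d\geq1$ and $n\geq1$ be integers. For every integer $k$, $$A_{d,k}=\sum_{j=0}^{d+1}2^{-d}\binom{d+1}{j}A_{d,2k-j}$$ and $$D(d,2n,k)=\sum_{j=0}^{d+1}\binom{d+1}{j}D(d,n,2k-j).$$
   Context: $S_d$ denotes the symmetric group on $\{1,\dots,d\}$, permutations being written as words $a_1a_2\cdots a_d$; a descent of such a permutation is an index $i\in\{1,\dots,d-1\}$ with $a_i>a_{i+1}$. The Eulerian number $A_{d,k}$ is the number of permutations in $S_d$ with exactly $k-1$ descents (so $A_{d,k}=0$ unless $1\leq k\leq d$). Indexed permutations: for $n\geq1$, $S_d^n$ is the set of pairs $(a,z)$ where $a=a_1\cdots a_d\in S_d$ and $z=(z_1,\dots,z_d)\in\{0,1,\dots,n-1\}^d$ (each letter $a_i$ is assigned the index $z_i$). A descent of $(a,z)$ is an $i\in\{1,\dots,d\}$ such that $z_i>z_{i+1}$, or $z_i=z_{i+1}$ and $a_i>a_{i+1}$, with the convention $a_{d+1}=d+1$, $z_{d+1}=0$. $D(d,n,k)$ is the number of elements of $S_d^n$ with exactly $k$ descents (so $D(d,n,k)=0$ unless $0\leq k\leq d$). *)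

(* Defs.v *)
From mathcomp Require Import all_boot all_order all_algebra all_fingroup.
Set Implicit Arguments. Unset Strict Implicit. Unset Printing Implicit Defensive.
Import Order.TTheory GRing.Theory Num.Theory.

(* Positions and letters are numbered from 0: the word a_1 ... a_d is         *)
(* a 0, ..., a (d - 1), with letters in {0, ..., d - 1}.                      *)

(* The value d at positions i >= d is the convention a_{d+1} = d + 1, shifted *)
(* by one like all other letters.                                             *)
Definition letter (d : nat) (a : 'S_d) (i : nat) : nat :=
  if insub i is Some j then a j else d.

(* The value 0 at positions i >= d is the convention z_{d+1} = 0.             *)
Definition index_at (d n : nat) (z : {ffun 'I_d -> 'I_n}) (i : nat) : nat :=
  if insub i is Some j then z j else 0.

Definition descents (d : nat) (a : 'S_d) : {set 'I_d} :=
  [set i : 'I_d | (i.+1 < d) && (letter a i.+1 < letter a i)].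

Definition eulerian (d : nat) (k : int) : nat :=
  #|[set a : 'S_d | (#|descents a|%:Z == k - 1)%R]|.

Definition indexed_perm (d n : nat) : finType :=
  ('S_d * {ffun 'I_d -> 'I_n})%type.

Definition idescents (d n : nat) (p : indexed_perm d n) : {set 'I_d} :=
  [set i : 'I_d | (index_at p.2 i.+1 < index_at p.2 i)
    || (index_at p.2 i == index_at p.2 i.+1)
       && (letter p.1 i.+1 < letter p.1 i)].

Definition indexed_eulerian (d n : nat) (k : int) : nat :=
  #|[set p : indexed_perm d n | (#|idescents p|%:Z == k)%R]|.

(* Main.v *)
Require Import Defs.
From mathcomp Require Import all_boot all_order all_algebra all_fingroup.
From mathcomp Require Import zify.
Import Order.TTheory GRing.Theory Num.Theory.

(** Both identities come from one bijection on bits, carried out while a word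
    of keys stays fixed.

    Give a word w_0, ..., w_d of keys below N a leading binary digit, which
    replaces w_i by w_i + N e_i with e_i in {0, 1}.  At each step the descents
    of the two words are tied by
      [w_i > w_(i+1)] + J_(i+1) + e_i
        = 2 [w_i + N e_i > w_(i+1) + N e_(i+1)] + e_(i+1),
    where J_(i+1) is the exclusive or of e_i, e_(i+1) and [w_i > w_(i+1)].
    Put J_0 = e_0; the sum over i telescopes ([shift_word_descents]) to
      des(w) + |J| = 2 des(w + N e) + e_d.
    For fixed w the map e |-> J is a bijection on (d+1)-bit vectors
    ([step_set_inj]), and there are C(d+1, j) vectors J with |J| = j.  So, for
    any family of words and any s, the sum over j of C(d+1, j) times the number
    of words with s - j descents counts the pairs (word, e) such that
    2 des(w + N e) + e_d = s ([sum_shift_words]).  The parity of s dictates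
    the last bit e_d ([sum_last_bit]).

    An indexed permutation (a, z) is read as the word of keys
    z_i (d+1) + a_i, with letters counted from 0; the conventional last entry
    is one more key, equal to d.  For s = 2k the last bit is 0, and adding n e_i to z_i makes
    (z, e) run once over all index vectors with values below 2n; this is the
    identity for D(d, 2n, k).

    For A_{d,k} the keys are the bare letters and s = 2k - 1, so that the last
    bit is 1, the added final key is the largest one, and des(w + N e) = k - 1.
    Indexing the remaining bits by letters instead of positions fixes a set L
    of letters that are moved above all others.  This only reorders
    the alphabet, so each of the 2^d sets L contributes A_{d,k}
    ([sum_relabel]), whence the factor 2^(-d). *)

Set Implicit Arguments.
Unset Strict Implicit.
Local Open Scope nat_scope.

(** * Leading binary digits and descents of words *)

Definition word_descents (m : nat) (w : nat -> nat) : nat :=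
  \sum_(i < m) (w i.+1 < w i).

Definition shift_word (N : nat) (e : nat -> bool) (w : nat -> nat) (i : nat) :=
  w i + N * e i.

(** The vector J attached to the word w and the bits e; it records at which
    steps the bit changes, corrected by the descents of w. *)
Definition bit_steps (w : nat -> nat) (e : nat -> bool) (i : nat) : bool :=
  if i is i'.+1 then e i'.+1 (+) e i' (+) (w i'.+1 < w i') else e 0.

Lemma eq_word_descents m w w' :
  (forall i, i <= m -> w i = w' i) -> word_descents m w = word_descents m w'.
Proof.
by move=> eq_w; apply: eq_bigr => i _; rewrite !eq_w // ltnW.
Qed.

(** The relation that drives everything: a local identity between descents and
    bits, which telescopes along the word. *)
Lemma shift_word_descents N w e m : (forall i, i <= m -> w i < N) ->
  word_descents m w + \sum_(i < m.+1) bit_steps w e i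
    = 2 * word_descents m (shift_word N e w) + e m.
Proof.
rewrite /word_descents; elim: m => [|m IHm] ltwN.
  by rewrite !big_ord0 big_ord1.
rewrite big_ord_recr [X in _ + X]big_ord_recr [in RHS]big_ord_recr /=.
have {}IHm := IHm (fun i lei => ltwN i (leqW lei)).
have := ltwN m (leqnSn m); have := ltwN m.+1 (leqnn _).
rewrite /shift_word in IHm *.
case: (e m) (e m.+1) IHm => [] [] /=; case: (ltnP (w m.+1) (w m)) => /=; lia.
Qed.

Lemma card_sum_bool (T : finType) (P : pred T) : #|[set t | P t]| = \sum_t P t.
Proof.
by rewrite -sum1_card big_mkcond; apply: eq_bigr => t _; rewrite inE; case: ifP.
Qed.

Section BitSets.

Variable d : nat.
Implicit Types (E : {set 'I_d.+1}) (w : nat -> nat).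

(** A set of positions stands for a bit vector; only arguments i <= d matter,
    where [inord] is faithful. *)
Definition bits E (i : nat) : bool := inord i \in E.

Definition step_set w E := [set i : 'I_d.+1 | bit_steps w (bits E) i].

(** The bits are recovered from left to right: e_0 = J_0, and e_(i+1) is
    determined by J_(i+1), e_i and w. *)
Lemma step_set_inj w : injective (step_set w).
Proof.
move=> E F /setP eqEF; apply/setP => i.
rewrite -(inord_val i) -/(bits E i) -/(bits F i).
have: i < d.+1 by []; elim: (val i) => [|j IHj] ltj.
  by have := eqEF ord0; rewrite !inE /=.
have := eqEF (Ordinal ltj); rewrite !inE /= (IHj (ltnW ltj)).
by do 2!move/addIb.
Qed.

Lemma sum_set_card (T : finType) (F : nat -> nat) :
  \sum_(A : {set T}) F #|A| = \sum_(0 <= j < #|T|.+1) 'C(#|T|, j) * F j.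
Proof.
rewrite big_mkord.
rewrite (partition_big (fun A : {set T} => inord #|A| : 'I_#|T|.+1) predT) //=.
apply: eq_bigr => j _; rewrite -(card_draws T j) -sum_nat_const.
apply: eq_big => [A | A /eqP <-]; last by rewrite inordK // ltnS max_card.
by rewrite inE -val_eqE /= inordK // ltnS max_card.
Qed.

(** The binomial coefficients arise by grouping the sets J
    according to their cardinal. *)
Lemma sum_shift_words (T : finType) N (w : T -> nat -> nat) s :
    (forall t i, i <= d -> w t i < N) ->
  \sum_t \sum_E (2 * word_descents d (shift_word N (bits E) (w t))
                   + (ord_max \in E) == s)
    = \sum_(0 <= j < d.+2)
        'C(d.+1, j) * \sum_t (word_descents d (w t) + j == s).
Proof.
move=> ltwN; have := sum_set_card 'I_d.+1
  (fun j => \sum_t (word_descents d (w t) + j == s)).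
rewrite card_ord => <-; rewrite [RHS]exchange_big /=; apply: eq_bigr => t _.
rewrite [RHS](reindex_inj (@step_set_inj (w t))) /=; apply: eq_bigr => E _.
have -> : (ord_max \in E) = bits E d.
  by congr (_ \in E); apply: val_inj; rewrite /= inordK.
rewrite -shift_word_descents; last exact: ltwN.
by rewrite card_sum_bool.
Qed.

End BitSets.

(** * Prescribing the last bit *)

Definition extend_set d (e : bool) (L : {set 'I_d}) : {set 'I_d.+1} :=
  [set i : 'I_d.+1 | if insub (val i) is Some j then j \in L else e].

Lemma bits_extend_ord d e (L : {set 'I_d}) (i : 'I_d) :
  bits (extend_set e L) i = (i \in L).
Proof. by rewrite /bits inE /= inordK ?valK // ltnS ltnW. Qed.

Lemma bits_extend_end d e (L : {set 'I_d}) : bits (extend_set e L) d = e.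
Proof. by rewrite /bits inE /= inordK ?insubF ?ltnn. Qed.

Lemma sum_extend_set d e (F : {set 'I_d.+1} -> nat) :
  \sum_(E : {set 'I_d.+1} | (ord_max \in E) == e) F E
    = \sum_(L : {set 'I_d}) F (extend_set e L).
Proof.
have restrictK (E : {set 'I_d.+1}) : (ord_max \in E) == e ->
    extend_set e (widen_ord (leqnSn d) @^-1: E) = E.
  move=> /eqP Ee; apply/setP => i; rewrite inE; case: insubP => [j _ ji | ].
    by rewrite inE; congr (_ \in E); apply: val_inj.
  rewrite -leqNgt => led; rewrite -Ee; congr (_ \in E).
  by apply/val_inj/anti_leq; rewrite led -ltnS ltn_ord.
rewrite (reindex_onto _ _ restrictK); apply: eq_bigl => L.
apply/andP; split.
  by rewrite inE insubF ?ltnn.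
by apply/eqP/setP => i; rewrite !inE valK.
Qed.

(** Since the two sides of the equation have last binary digits
    [ord_max \in E] and e, these agree and the halves agree. *)
Lemma sum_last_bit d (F : {set 'I_d.+1} -> nat) m (e : bool) :
  \sum_E (2 * F E + (ord_max \in E) == 2 * m + e)
    = \sum_L (F (extend_set e L) == m).
Proof.
rewrite -(sum_extend_set e (fun E => F E == m : nat)) [RHS]big_mkcond /=.
apply: eq_bigr => E _; set x := F E.
have -> : (2 * x + (ord_max \in E) == 2 * m + e)
            = ((ord_max \in E) == e) && (x == m).
  by case: (_ \in E); case: e; apply/eqP/eqP => /=; lia.
by case: eqP.
Qed.

(** * Permutations as words of keys *)

Lemma letter_ord d (a : 'S_d) (i : 'I_d) : letter a i = a i.
Proof. by rewrite /letter valK. Qed.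

Lemma letter_end d (a : 'S_d) : letter a d = d.
Proof. by rewrite /letter insubF ?ltnn. Qed.

Lemma letter_le d (a : 'S_d) i : letter a i <= d.
Proof. by rewrite /letter; case: insubP => [j _ _ | //]; exact: ltnW. Qed.

Lemma index_at_ord d n (z : {ffun 'I_d -> 'I_n}) (i : 'I_d) : index_at z i = z i.
Proof. by rewrite /index_at valK. Qed.

Lemma index_at_end d n (z : {ffun 'I_d -> 'I_n}) : index_at z d = 0.
Proof. by rewrite /index_at insubF ?ltnn. Qed.

Lemma index_at_lt d n (z : {ffun 'I_d -> 'I_n}) i : 0 < n -> index_at z i < n.
Proof. by move=> n_gt0; rewrite /index_at; case: insubP. Qed.

(** Base d+1 makes the order of keys lexicographic in (index, letter), because
    letters, the conventional final one included, are at most d. *)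
Definition indexed_word d n (p : indexed_perm d n) (i : nat) : nat :=
  index_at p.2 i * d.+1 + letter p.1 i.

Lemma indexed_word_lt d n (p : indexed_perm d n) i :
  0 < n -> indexed_word p i < n * d.+1.
Proof.
move=> n_gt0; have := index_at_lt p.2 i n_gt0; have := letter_le p.1 i.
rewrite /indexed_word; nia.
Qed.

Lemma card_idescents d n (p : indexed_perm d n) :
  #|idescents p| = word_descents d (indexed_word p).
Proof.
rewrite card_sum_bool; apply: eq_bigr => i _; congr nat_of_bool.
have := letter_le p.1 i; have := letter_le p.1 i.+1; rewrite /indexed_word.
move: (letter _ _) (letter _ _) (index_at _ _) (index_at _ _) => x y u v.
case: (ltngtP u v) => /=; nia.
Qed.

(** A final key d is never smaller than its predecessor, so closing the word
    with it adds no descent. *)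
Lemma card_descents d (a : 'S_d) : #|descents a| = word_descents d (letter a).
Proof.
rewrite card_sum_bool; apply: eq_bigr => i _; congr nat_of_bool.
have [//|] := ltnP i.+1 d; rewrite leq_eqVlt ltnS leqNgt ltn_ord orbF.
by move/eqP <-; rewrite letter_end ltnNge letter_le.
Qed.

Lemma indexed_eulerianE d n s j :
  indexed_eulerian d n (s%:Z - j%:Z)%R
    = \sum_(p : indexed_perm d n) (word_descents d (indexed_word p) + j == s).
Proof.
rewrite /indexed_eulerian card_sum_bool; apply: eq_bigr => p _.
by rewrite card_idescents eq_sym subr_eq -PoszD eqz_nat eq_sym.
Qed.

Lemma eulerianE d s j :
  eulerian d (s.+1%:Z - j%:Z)%R
    = \sum_(a : 'S_d) (word_descents d (letter a) + j == s).
Proof.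
rewrite /eulerian card_sum_bool; apply: eq_bigr => a _.
by rewrite card_descents; congr nat_of_bool; lia.
Qed.

Lemma indexed_eulerian_neg d n (k : int) : (k < 0)%R -> indexed_eulerian d n k = 0.
Proof.
by move=> k_lt0; apply: eq_card0 => p; rewrite !inE; apply/negbTE/eqP; lia.
Qed.

Lemma eulerian_nonpos d (k : int) : (k <= 0)%R -> eulerian d k = 0.
Proof.
by move=> k_le0; apply: eq_card0 => p; rewrite !inE; apply/negbTE/eqP; lia.
Qed.

Lemma sum_indexed_perm d n (F : indexed_perm d n -> nat) :
  \sum_p F p = \sum_a \sum_z F (a, z).
Proof. by rewrite pair_bigA; apply: eq_bigr => -[]. Qed.

(** * Doubling the number of indices *)

Section DoubleIndices.

Variables d n : nat.
Hypothesis n_gt0 : 0 < n.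

Fact digit_subproof (i : 'I_n) (b : bool) : i + n * b < 2 * n.
Proof. by have := ltn_ord i; case: b; lia. Qed.

Definition add_digit (zL : {ffun 'I_d -> 'I_n} * {set 'I_d}) :
    {ffun 'I_d -> 'I_(2 * n)} :=
  [ffun i => Ordinal (digit_subproof (zL.1 i) (i \in zL.2))].

Lemma add_digit_bij : bijective add_digit.
Proof.
exists (fun y : {ffun 'I_d -> 'I_(2 * n)} =>
          ([ffun i => Ordinal (ltn_pmod (y i) n_gt0)], [set i | n <= y i])).
  move=> [z L]; congr (_, _).
    apply/ffunP => i; apply: val_inj; rewrite !ffunE /=.
    by rewrite addnC mulnC modnMDl modn_small.
  apply/setP => i; rewrite inE ffunE /=; case: (i \in L) => /=; first by lia.
  by rewrite muln0 addn0 leqNgt ltn_ord.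
move=> y; apply/ffunP => i; apply: val_inj; rewrite !ffunE /= inE.
have := ltn_ord (y i); case: (leqP n (y i)) => [le_ny | lt_yn] lt_y2n.
  by rewrite -[X in X %% n](subnK le_ny) modnDr modn_small; lia.
by rewrite modn_small // muln0 addn0.
Qed.

Lemma indexed_word_add_digit (a : 'S_d) z L i : i <= d ->
  indexed_word ((a, add_digit (z, L)) : indexed_perm d (2 * n)) i
    = shift_word (n * d.+1) (bits (extend_set false L))
        (indexed_word ((a, z) : indexed_perm d n)) i.
Proof.
rewrite /indexed_word /shift_word leq_eqVlt => /predU1P[-> | lt_id] /=.
  by rewrite !index_at_end bits_extend_end muln0 addn0.
rewrite -[i]/(val (Ordinal lt_id)) !index_at_ord bits_extend_ord ffunE /=.
by rewrite mulnDl addnAC mulnAC.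
Qed.

(** Adding the bits with last bit 0 to indexed permutations with n indices
    produces exactly those with 2n indices, with descents counted by
    2 des + 0 = 2k. *)
Lemma indexed_eulerian_double (k : int) :
  indexed_eulerian d (2 * n) k
    = \sum_(0 <= j < d.+2) 'C(d.+1, j) * indexed_eulerian d n (2 * k - j%:Z)%R.
Proof.
case: k => [m | m]; last first.
  rewrite indexed_eulerian_neg // big1 // => j _.
  by rewrite indexed_eulerian_neg ?muln0 //; lia.
under eq_bigr do rewrite -[(2 * _)%R]/((2 * m)%N%:Z)%R indexed_eulerianE.
rewrite -(@sum_shift_words d _ (n * d.+1)); last by move=> *; apply: indexed_word_lt.
have -> : Posz m = (m%:Z - 0%:Z)%R by rewrite subr0.
rewrite indexed_eulerianE !sum_indexed_perm; apply: eq_bigr => a _.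
rewrite (reindex _ (onW_bij _ add_digit_bij)) /=.
transitivity (\sum_z \sum_L
  (word_descents d (indexed_word ((a, add_digit (z, L)) : indexed_perm _ _)) + 0
     == m) : nat).
  by rewrite pair_bigA; apply: eq_bigr => -[].
apply: eq_bigr => z _; rewrite -[2 * m]addn0 (sum_last_bit _ m false).
apply: eq_bigr => L _; rewrite addn0; congr ((_ == m) : nat).
exact/eq_word_descents/indexed_word_add_digit.
Qed.

End DoubleIndices.

(** * Reordering the alphabet *)

Section Relabel.

Variable d : nat.

Fact rank_subproof (f : 'I_d -> nat) (x : 'I_d) : #|[set y | f y < f x]| < d.
Proof.
rewrite -[X in _ < X]card_ord; apply/proper_card/properP; split.
  exact/subsetP.
by exists x; rewrite // inE ltnn.
Qed.

(** The permutation sends x to its rank, the number of letters whose value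
    lies below f x. *)
Lemma order_isomorphic_perm (f : 'I_d -> nat) : injective f ->
  exists s : 'S_d, forall x y, (s x < s y) = (f x < f y).
Proof.
move=> f_inj; pose r x := Ordinal (rank_subproof f x).
have r_lt x y : f x < f y -> r x < r y.
  move=> fxy; apply/proper_card/properP; split.
    by apply/subsetP => u; rewrite !inE => /ltn_trans->.
  by exists x; rewrite !inE ?ltnn.
have r_mono x y : (r x < r y) = (f x < f y).
  case: (ltngtP (f x) (f y)) => [/r_lt // | /r_lt | /f_inj ->]; last by rewrite ltnn.
  by move=> r_yx; apply/negbTE; rewrite -leqNgt ltnW.
have r_inj : injective r.
  move=> x y rxy; apply: f_inj.
  by case: (ltngtP (f x) (f y)) => //; rewrite -r_mono rxy ltnn.
by exists (perm r_inj) => x y; rewrite !permE.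
Qed.

(** An injective f induces the same order on letters as some permutation s, so
    its words have the descents of the permutations a * s. *)
Lemma sum_relabel (f : 'I_d -> nat) (top : nat) (F : nat -> nat) : injective f ->
    (forall x, f x <= top) ->
  \sum_(a : 'S_d) F (word_descents d (fun i =>
      if insub i is Some j then f (a j) else top))
    = \sum_(a : 'S_d) F (word_descents d (letter a)).
Proof.
move=> f_inj le_top; have [s sP] := order_isomorphic_perm f_inj.
rewrite [RHS](reindex_inj (mulIg s)); apply: eq_bigr => a _; congr F.
apply: eq_bigr => i _; congr nat_of_bool.
rewrite /letter valK; case: insubP => [j _ _ | _]; first by rewrite !permM sP.
by rewrite !ltnNge le_top ltnW.
Qed.

(** The letters of L are moved above all the others, in unchanged order. *)
Definition marked_letter (L : {set 'I_d}) (x : 'I_d) : nat := x + d.+1 * (x \in L).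

Lemma marked_letter_inj L : injective (marked_letter L).
Proof.
move=> x y; have := ltn_ord x; have := ltn_ord y; rewrite /marked_letter.
move=> ltx lty eq_xy; apply: val_inj => /=; move: eq_xy.
by case: (x \in L); case: (y \in L) => /=; lia.
Qed.

Lemma preimset_perm_inj (a : 'S_d) : injective (fun L : {set 'I_d} => a @^-1: L).
Proof.
move=> L M /setP eqLM; apply/setP => x.
by have := eqLM ((a^-1)%g x); rewrite !inE permKV.
Qed.

(** Bits with last bit 1, transported from positions to letters. *)
Lemma eulerian_double (k : int) :
  2 ^ d * eulerian d k
    = \sum_(0 <= j < d.+2) 'C(d.+1, j) * eulerian d (2 * k - j%:Z)%R.
Proof.
have [k_le0 | k_gt0] := lerP k 0%R.
  rewrite eulerian_nonpos // muln0 big1 // => j _.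
  by rewrite eulerian_nonpos ?muln0 //; lia.
have [m ->] : exists m : nat, k = m.+1 by exists `|k|.-1; lia.
under eq_bigr do rewrite -[(2 * _)%R]/((2 * m.+1)%N%:Z)%R mulnS eulerianE.
rewrite -(@sum_shift_words d _ d.+1); last by move=> *; rewrite ltnS letter_le.
(* The preimage under a turns a set of letters into a set of positions. *)
under [RHS]eq_bigr => a _ do
  rewrite -[(2 * m).+1]addn1 (sum_last_bit _ m true)
    (reindex_inj (@preimset_perm_inj a)).
have -> : 2 ^ d = #|{set 'I_d}|.
  by rewrite -cardsT -powersetT card_powerset cardsT card_ord.
rewrite exchange_big /= -sum_nat_const; apply: eq_bigr => L _.
(* With last bit 1 the closing key d becomes d + (d + 1), above all others. *)
rewrite -[X in eulerian d X]subr0 (eulerianE d m 0).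
rewrite -(@sum_relabel _ (d + d.+1) (fun r => r + 0 == m)
            (@marked_letter_inj L)); last first.
  by move=> x; rewrite /marked_letter; have := ltn_ord x; case: (_ \in _); lia.
apply: eq_bigr => a _; rewrite addn0; congr ((_ == m) : nat).
apply: eq_word_descents => i; rewrite /shift_word leq_eqVlt.
case/predU1P => [-> | lt_id].
  by rewrite letter_end bits_extend_end insubF ?ltnn // muln1.
by rewrite -[i]/(val (Ordinal lt_id)) letter_ord bits_extend_ord valK inE.
Qed.

End Relabel.

Local Open Scope ring_scope.

Theorem corollary1p3 (d n : nat) (hd : (1 <= d)%N) (hn : (1 <= n)%N) (k : int) :
  ((eulerian d k)%:R : rat)
    = \sum_(0 <= j < d.+2)
        2%:R ^- d * ('C(d.+1, j))%:R * (eulerian d (2 * k - j%:Z))%:R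
  /\ indexed_eulerian d (2 * n)%N k
    = (\sum_(0 <= j < d.+2)
        'C(d.+1, j) * indexed_eulerian d n (2 * k - j%:Z)%R)%N.
Proof.
split; last exact: indexed_eulerian_double.
have two_d_neq0 : 2%:R ^+ d != 0 :> rat by rewrite expf_neq0.
under eq_bigr do rewrite -mulrA -natrM.
by rewrite -mulr_sumr -natr_sum -eulerian_double natrM natrX mulKf.
Qed.
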